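(* Let $q$ be a prime power, $m\geq5$, $\ell\geq1$, $F=\mathbb{F}_{q^m}$, and let $W\leq F^{2\ell}$ be a maximum scattered $q$-system. With $H_0,D_0,G_0,U_0$ as in the context, let $s$ be an integer with $1\leq s<(m-2)/2$. Then for every $\mathbb{F}_q$-linear map $\varphi:U_0\to F^s$, with associated $\Phi$, $U_\varphi$, $C_\Phi$, $D_\Phi$ and $Z$: (1) The system $U_\varphi$ is extremal $(m-3)$-scattered and quasi-maximum. Its associated code $C_\Phi$ is nondegenerate, while $D_\Phi=C_\Phi^\perp$ is quasi-MRD with parameters $[\ell m+s,2\ell,m-1]_{q^m/q}$. (2) $d_i(D_\Phi)\geq d_i(D_0)$ for all $1\leq i\leq 2\ell$. (3) If the independence condition $\dim_{\mathbb{F}_q}\overline E_Z=s$ holds, then both $C_\Phi$ and $D_\Phi$ are nondegenerate quasi-MRD codes, with parameters $$C_\Phi:\ [\ell m+s,\ell(m-2)+s,2]_{q^m/q},\qquad D_\Phi:\ [\ell m+s,2\ell,m-1]_{q^m/q}.$$ (4) If $\dim_{\mathbb{F}_q}\overline E_Z<s$, then $d(C_\Phi)=1$.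
   Context: Systems. An $[n,k]_{q^m/q}$ $q$-system is an $n$-dimensional $\mathbb{F}_q$-subspace $U\leq F^k$ with $\langle U\rangle_F=F^k$; $n$ is its rank. It is $h$-scattered if $\dim_{\mathbb{F}_q}(U\cap H)\leq h$ for every $h$-dimensional $F$-subspace $H\leq F^k$; an $h$-scattered system is extremal if $n=\lfloor km/(h+1)\rfloor$, and an extremal one is quasi-maximum if $h+1\nmid km$. A maximum scattered system in $F^{2\ell}$ is a $1$-scattered $q$-system of rank $\ell m$. Codes. An $[n,r]_{q^m/q}$ code is an $r$-dimensional $F$-subspace $C\leq F^n$. The rank weight of $x=(x_1,\ldots,x_n)\in F^n$ is $\dim_{\mathbb{F}_q}\langle x_1,\ldots,x_n\rangle_{\mathbb{F}_q}$; $d(C)$ is the minimum rank weight of a nonzero word, and an $[n,r,d]_{q^m/q}$ code is one with $d(C)=d$. $C^\perp=\{y\in F^n: xy^\top=0\ \forall x\in C\}$. A code is nondegenerate if the columns of a generator matrix are $\mathbb{F}_q$-linearly independent; the $\mathbb{F}_q$-span of these columns is then a $q$-system, and code and system are called associated. For $n>m$ the rank defect is $\operatorname{Rdef}(C)=m-\lceil mr/n\rceil-d(C)+1$, and $C$ is quasi-MRD if $\operatorname{Rdef}(C)=0$. Expanding $x\in F^n$ with respect to an $\mathbb{F}_q$-basis of $F$ as an $m\times n$ matrix over $\mathbb{F}_q$, let $\operatorname{Rsupp}_q(x)\le\mathbb{F}_q^n$ be its row space; for an $F$-subspace $V\leq F^n$ let $\operatorname{Rsupp}_q(V)$ be the sum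 of the supports of the elements of an $F$-basis of $V$ (independent of choices). The $i$-th generalized rank weight is $d_i(C)=\min\{\dim_{\mathbb{F}_q}\operatorname{Rsupp}_q(V): V\leq C,\ \dim_FV=i\}$. Construction. Put $n_0=\ell m$, $k_0=\ell(m-2)$. Choose an ordered $\mathbb{F}_q$-basis of $W$ as the columns of $H_0\in F^{2\ell\times n_0}$, let $D_0$ be the $F$-row space of $H_0$, choose a generator matrix $G_0\in F^{k_0\times n_0}$ of $D_0^\perp$ with columns $g_1,\ldots,g_{n_0}$ (these are $\mathbb{F}_q$-independent), and let $U_0\leq F^{k_0}$ be their $\mathbb{F}_q$-span. For an $\mathbb{F}_q$-linear map $\varphi:U_0\to F^s$ define $$U_\varphi=\{(u,\varphi(u)+a):u\in U_0,\ a\in\mathbb{F}_q^s\}\leq F^{k_0+s},$$ $$\Phi=[\varphi(g_1)\ \cdots\ \varphi(g_{n_0})]\in F^{s\times n_0},\qquad G_\Phi=\begin{pmatrix}G_0&0\\ \Phi&I_s\end{pmatrix},$$ let $C_\Phi$ be the $F$-row space of $G_\Phi$, and $D_\Phi=C_\Phi^\perp=\{(x,-x\Phi^\top):x\in D_0\}$, which has generator matrix $[H_0\mid Z]$ with $Z=-H_0\Phi^\top$. If $z_1,\ldots,z_s$ are the columns of $Z$, put $\overline E_Z=\langle z_1+W,\ldots,z_s+W\rangle_{\mathbb{F}_q}\leq F^{2\ell}/W$. *)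

(* Defs.v *)
From HB Require Import structures.
From mathcomp Require Import all_boot all_order all_algebra fieldext.
From mathcomp Require Import boolp.

Set Implicit Arguments.
Unset Strict Implicit.
Unset Printing Implicit Defensive.

Import Order.TTheory GRing.Theory Num.Theory.
Local Open Scope ring_scope.

(* Throughout, K is the finite field F_q (q = #|K|) and L is F = F_{q^m}, an  *)
(* extension of K with m = \dim {:L}. Vectors of systems are columns, words   *)
(* of codes are rows. F-subspaces are subspaces of the L-space 'cV[L]_k (or   *)
(* 'rV[L]_n); F_q-subspaces of F^k are subspaces of the K-space qvec L k,     *)
(* which has the same underlying vectors as 'cV[L]_k.                         *)

Definition qvec (K : fieldType) (L : fieldExtType K) (k : nat) : Type :=
  'cV[L]_k.

Section QvecStructure.
Import VectorInternalTheory.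
Variables (K : fieldType) (L : fieldExtType K) (k : nat).

HB.instance Definition _ := GRing.Zmodule.copy (qvec L k) 'cV[L]_k.

Definition qscale (a : K) (v : qvec L k) : qvec L k :=
  map_mx (fun x : L => a *: x) v.

Fact qscaleA a b v : qscale a (qscale b v) = qscale (a * b) v.
Proof. by apply/matrixP=> i j; rewrite !mxE scalerA. Qed.

Fact qscale1 : left_id 1 qscale.
Proof. by move=> v; apply/matrixP=> i j; rewrite !mxE scale1r. Qed.

Fact qscaleDr : right_distributive qscale +%R.
Proof. by move=> a u v; apply/matrixP=> i j; rewrite !mxE scalerDr. Qed.

Fact qscaleDl v : {morph qscale^~ v : a b / a + b}.
Proof. by move=> a b; apply/matrixP=> i j; rewrite !mxE scalerDl. Qed.

HB.instance Definition _ := GRing.Zmodule_isLmodule.Build K (qvec L k)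
  qscaleA qscale1 qscaleDr qscaleDl.

Definition qvec_ffun (v : qvec L k) : {ffun 'I_k -> L} := [ffun i => v i 0].

Fact qvec_ffun_is_linear : linear qvec_ffun.
Proof. by move=> a u v; apply/ffunP=> i; rewrite !ffunE !mxE. Qed.

Fact qvec_vect_iso : Vector.axiom (dim {ffun 'I_k -> L}) (qvec L k).
Proof.
exists (fun v => v2r (qvec_ffun v)) => [a u v|].
  by rewrite qvec_ffun_is_linear linearP.
exists (fun r => (\col_i (r2v r : {ffun 'I_k -> L}) i) : qvec L k) => [v|r].
  by apply/matrixP=> i j; rewrite mxE v2rK ffunE (ord1 j).
rewrite -[RHS]r2vK; congr v2r.
by apply/ffunP=> i; rewrite ffunE mxE.
Qed.

HB.instance Definition _ := Lmodule_hasFinDim.Build K (qvec L k) qvec_vect_iso.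

End QvecStructure.

(* The least element of a set of natural numbers (0 for the empty set).       *)
Definition minnat (P : nat -> Prop) : nat :=
  match pselect (exists n, (fun n => `[< P n >]) n) with
  | left exP => ex_minn exP
  | right _ => 0
  end.

Lemma minnatP (P : nat -> Prop) :
  (exists n, P n) -> P (minnat P) /\ (forall n, P n -> (minnat P <= n)%N).
Proof.
move=> [n Pn]; rewrite /minnat; case: pselect => [exP|[]]; last first.
  by exists n; apply/asboolP.
case: ex_minnP => i /asboolP Pi le_i; split=> // j Pj.
by apply: le_i; apply/asboolP.
Qed.

(* The quotient vT / W, realised on the complement W^C of W: the projection   *)
(* vpi W is linear and onto, with kernel W (vpi_eq, limg_vpi).                *)
Section Quotient.
Variables (K : fieldType) (vT : vectType K) (W : {vspace vT}).

Definition vquot := subvs_of (W^C)%VS.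

Definition vpi (v : vT) : vquot := vsproj (W^C)%VS (daddv_pi (W^C)%VS W v).

Fact vpi_is_linear : linear vpi.
Proof. by move=> a u v; rewrite /vpi !linearP. Qed.
HB.instance Definition _ := GRing.isLinear.Build K vT vquot *:%R vpi
  vpi_is_linear.

Fact vpi_cap : (W^C :&: W = 0)%VS. Proof. by rewrite capvC capv_compl. Qed.

Lemma vpi_eq u v : (vpi u = vpi v) <-> (u - v \in W).
Proof.
have ker w : vpi w = 0 <-> w \in W.
  have wE : daddv_pi (W^C)%VS W w + daddv_pi W (W^C)%VS w = w.
    by apply: daddv_pi_add vpi_cap _; rewrite addvC addv_complf memvf.
  have pE : vsval (vpi w) = daddv_pi (W^C)%VS W w.
    by rewrite vsprojK ?memv_pi.
  split=> [w0|Ww].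
    by rewrite -wE -pE w0 linear0 add0r memv_pi.
  apply/val_inj; rewrite /= pE; apply/eqP; rewrite -memv0 -vpi_cap memv_cap.
  rewrite memv_pi /=; move/(canRL (addrK _)): wE => ->.
  by rewrite memvB ?memv_pi.
rewrite -ker raddfB /=; split=> [->|/eqP]; first exact: subrr.
by rewrite subr_eq0 => /eqP.
Qed.

Lemma limg_vpi : limg (linfun vpi) = fullv.
Proof.
apply/vspaceP=> y; rewrite memvf; apply/memv_imgP.
exists (vsval y); rewrite ?memvf // lfunE /= /vpi daddv_pi_id ?subvsP ?vsvalK //.
exact: vpi_cap.
Qed.

End Quotient.

Section Codes.
Variables (K : finFieldType) (L : fieldExtType K).

(* An F-subspace of F^k regarded as an F_q-subspace. *)
Definition Fq_of k (H : {vspace 'cV[L]_k}) : {vspace qvec L k} :=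
  <<[seq (b *: h : 'cV[L]_k) | b <- vbasis {:L}, h <- vbasis H] : seq (qvec L k)>>%VS.

Lemma mem_Fq_of k (H : {vspace 'cV[L]_k}) (v : 'cV[L]_k) :
  ((v : qvec L k) \in Fq_of H) = (v \in H).
Proof.
have sc (a : K) (u : 'cV[L]_k) : a *: (u : qvec L k) = (a%:A : L) *: u.
  by apply/matrixP=> i j; rewrite !mxE mulr_algl.
apply/idP/idP=> [Hv|Hv].
  have [X /= memX ->] : exists2 X : 'I_(size [seq (b *: h : 'cV[L]_k) |
      b <- vbasis {:L}, h <- vbasis H]) -> K * 'cV[L]_k,
      forall i, (X i).2 \in H & v = \sum_i ((X i).1%:A : L) *: (X i).2.
    set S := [seq _ | b <- _, h <- _].
    exists (fun i => (coord (in_tuple (S : seq (qvec L k))) i v, S`_i)) => [i|].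
      have /allpairsP[[b h] [_ Hh /= ->]] : S`_i \in S by rewrite mem_nth.
      by rewrite memvZ // vbasis_mem.
    rewrite {1}(coord_span (X := in_tuple (S : seq (qvec L k))) Hv) /=.
    by apply: eq_bigr => i _; rewrite sc.
  by apply: memv_suml => i _; rewrite memvZ.
rewrite (coord_vbasis Hv).
apply: (big_ind (fun x : 'cV[L]_k => (x : qvec L k) \in Fq_of H)) => [|x y|i _].
- exact: (mem0v (Fq_of H)).
- exact: (@memvD _ _ (Fq_of H)).
rewrite (coord_vbasis (memvf (coord (vbasis H) i v))) scaler_suml.
apply: (big_ind (fun x : 'cV[L]_k => (x : qvec L k) \in Fq_of H)) => [|x y|j _].
- exact: (mem0v (Fq_of H)).
- exact: (@memvD _ _ (Fq_of H)).
rewrite -mulr_algl -scalerA -sc memvZ //; apply: memv_span.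
by apply: allpairs_f; rewrite mem_nth ?size_tuple.
Qed.

Definition Fspan k (U : {vspace qvec L k}) : {vspace 'cV[L]_k} :=
  <<(vbasis U : seq (qvec L k)) : seq 'cV[L]_k>>%VS.

Lemma Fspan_subP k (U : {vspace qvec L k}) (H : {vspace 'cV[L]_k}) :
  (Fspan U <= H)%VS <-> (forall u, u \in U -> (u : 'cV[L]_k) \in H).
Proof.
split=> [sUH u Uu|sUH].
  rewrite -mem_Fq_of (coord_vbasis Uu); apply: memv_suml => i _.
  apply: memvZ; rewrite mem_Fq_of; apply: (subvP sUH).
  by apply: memv_span; rewrite mem_nth ?size_tuple.
by apply/span_subvP=> u Uu; apply: sUH; apply: vbasis_mem.
Qed.

Definition q_system k (n : nat) (U : {vspace qvec L k}) : Prop :=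
  \dim U = n /\ Fspan U = fullv.

Definition scattered_system k (n h : nat) (U : {vspace qvec L k}) : Prop :=
  q_system n U /\
  forall H : {vspace 'cV[L]_k}, \dim H = h -> (\dim (U :&: Fq_of H) <= h)%N.

Definition extremal_system k (n h : nat) (U : {vspace qvec L k}) : Prop :=
  scattered_system n h U /\ n = ((k * \dim {:L}) %/ h.+1)%N.

Definition quasi_maximum_system k (n h : nat) (U : {vspace qvec L k}) : Prop :=
  extremal_system n h U /\ ~~ (h.+1 %| k * \dim {:L})%N.

Definition maximum_scattered l (W : {vspace qvec L (2 * l)}) : Prop :=
  scattered_system (l * \dim {:L}) 1 W.

Definition rank_weight n (x : 'rV[L]_n) : nat :=
  \dim <<[seq x ord0 j | j <- enum 'I_n]>>%VS.

Definition min_distance n (C : {vspace 'rV[L]_n}) : nat :=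
  minnat (fun w => exists x, [/\ x \in C, x != 0 & rank_weight x = w]).

(* [n, r, d] code; the length n is carried by the type of C. *)
Definition code_params n (C : {vspace 'rV[L]_n}) (r d : nat) : Prop :=
  \dim C = r /\ min_distance C = d.

Definition dual_code n (C : {vspace 'rV[L]_n}) : {vspace 'rV[L]_n} :=
  (\bigcap_(i < \dim C) lker (linfun (mulmxr ((vbasis C)`_i)^T)))%VS.

Lemma mem_dual_code n (C : {vspace 'rV[L]_n}) (y : 'rV[L]_n) :
  (y \in dual_code C) <-> (forall x, x \in C -> x *m y^T = 0).
Proof.
have tr0 (x : 'rV[L]_n) : x *m y^T = 0 <-> y *m x^T = 0.
  by rewrite -[y *m _]trmxK trmx_mul trmxK; split=> [->|/(canRL trmxK)->];
    rewrite trmx0.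
split=> [/subv_bigcapP yC x|yC].
  move/coord_vbasis->; rewrite mulmx_suml big1 // => i _.
  rewrite -scalemxAl (_ : _ *m _ = 0) ?scaler0 //; apply/tr0.
  by have := yC i isT; rewrite -memvE memv_ker lfunE => /eqP.
rewrite memvE; apply/subv_bigcapP=> i _; rewrite -memvE memv_ker lfunE /=.
by apply/eqP/tr0/yC/vbasis_mem/mem_nth; rewrite size_tuple.
Qed.

Definition row_code r n (A : 'M[L]_(r, n)) : {vspace 'rV[L]_n} :=
  <<[seq row i A | i <- enum 'I_r]>>%VS.

Definition qcols r n (A : 'M[L]_(r, n)) : seq (qvec L r) :=
  [seq (col j A : qvec L r) | j <- enum 'I_n].

Definition generator_matrix r n (C : {vspace 'rV[L]_n}) (G : 'M[L]_(r, n)) :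
  Prop := basis_of C [seq row i G | i <- enum 'I_r].

Definition nondegenerate_code n (C : {vspace 'rV[L]_n}) : Prop :=
  exists G : 'M[L]_(\dim C, n), generator_matrix C G /\ free (qcols G).

Definition associated k n (C : {vspace 'rV[L]_n}) (U : {vspace qvec L k}) :
  Prop :=
  exists G : 'M[L]_(k, n),
    [/\ generator_matrix C G, free (qcols G) & U = <<qcols G>>%VS].

Definition Rdef n (C : {vspace 'rV[L]_n}) : int :=
  (\dim {:L})%:Z - Num.ceil ((\dim {:L} * \dim C)%:R / n%:R : rat)
  - (min_distance C)%:Z + 1.

Definition quasi_MRD n (C : {vspace 'rV[L]_n}) : Prop :=
  (\dim {:L} < n)%N /\ Rdef C = 0.

Definition expand n (x : 'rV[L]_n) : 'M[K]_(\dim {:L}, n) :=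
  \matrix_(i, j) coord (vbasis {:L}) i (x 0 j).

Definition Rsupp n (x : 'rV[L]_n) : {vspace 'rV[K]_n} :=
  <<[seq row i (expand x) | i <- enum 'I_(\dim {:L})]>>%VS.

Definition Rsuppv n (V : {vspace 'rV[L]_n}) : {vspace 'rV[K]_n} :=
  (\sum_(x <- vbasis V) Rsupp x)%VS.

Definition gen_rank_weight n (i : nat) (C : {vspace 'rV[L]_n}) : nat :=
  minnat (fun w => exists V : {vspace 'rV[L]_n},
    [/\ (V <= C)%VS, \dim V = i & \dim (Rsuppv V) = w]).

Section Construction.
Variables (k0 n0 s : nat) (G0 : 'M[L]_(k0, n0)).

Definition U0 : {vspace qvec L k0} := <<qcols G0>>%VS.

Variable phi : 'Hom(subvs_of U0, qvec L s).

Definition Uphi_vec (p : subvs_of U0 * 'cV[K]_s) : qvec L (k0 + s) :=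
  col_mx (vsval p.1) (phi p.1 + map_mx (in_alg L) p.2).

Fact Uphi_vec_is_linear : linear Uphi_vec.
Proof.
move=> a p1 p2; rewrite /Uphi_vec /= linearP; apply/matrixP=> i j.
rewrite !mxE; case: splitP => t _; rewrite !mxE //=.
by rewrite scalerDr scalerDl -scalerA addrACA.
Qed.
HB.instance Definition _ := GRing.isLinear.Build K
  (subvs_of U0 * 'cV[K]_s)%type (qvec L (k0 + s)) *:%R Uphi_vec
  Uphi_vec_is_linear.

Definition Uphi : {vspace qvec L (k0 + s)} := limg (linfun Uphi_vec).

Lemma mem_Uphi v :
  (v \in Uphi) <-> exists (u : subvs_of U0) (a : 'cV[K]_s),
    v = col_mx (vsval u) (phi u + map_mx (in_alg L) a).
Proof.
split=> [/memv_imgP[[u a] _ ->]|[u [a ->]]].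
  by exists u, a; rewrite lfunE.
apply/memv_imgP; exists (u, a); first exact: memvf.
by rewrite lfunE.
Qed.

(* vsproj U0 (col j G0) is the column g_j as an element of U0. *)
Definition Phi : 'M[L]_(s, n0) :=
  \matrix_(i, j) (phi (vsproj U0 (col j G0)) : 'cV[L]_s) i 0.

Definition GPhi : 'M[L]_(k0 + s, n0 + s) := block_mx G0 0 Phi 1%:M.

Definition CPhi : {vspace 'rV[L]_(n0 + s)} := row_code GPhi.

Definition DPhi : {vspace 'rV[L]_(n0 + s)} := dual_code CPhi.

Definition Zmat r (H0 : 'M[L]_(r, n0)) : 'M[L]_(r, s) := - (H0 *m Phi^T).

End Construction.

(* The image of the F_q-span of the columns of Z in F^r / W. *)
Definition Ebar r s (W : {vspace qvec L r}) (Z : 'M[L]_(r, s)) :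
  {vspace vquot W} := <<[seq vpi W z | z <- qcols Z]>>%VS.

End Codes.

(* Main.v *)
From HB Require Import structures.
Require Import Defs.
From mathcomp Require Import all_boot all_order all_algebra fieldext.
From mathcomp Require Import boolp zify.

Set Implicit Arguments.
Unset Strict Implicit.
Unset Printing Implicit Defensive.

Import Order.TTheory GRing.Theory Num.Theory.
Local Open Scope ring_scope.

(** Everything rests on one property of a maximum scattered system W in F^(2l):
if b1 and b2 are F_q-independent scalars, then F^(2l) = b1 W + b2 W
([maximum_scattered_sum]). Indeed b1 W and b2 W have rank l m each, and a
nonzero common vector b1 w1 = b2 w2 would put w1 and w2 on one F-line, hence, W
being scattered, on one F_q-line, making b2 / b1 an element of F_q.

Consequently the code D0 spanned by the rows of H0 has no nonzero word of rank
weight at most m - 2 ([maximum_scattered_functional]). If the entries of v H0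
lie in an F_q-subspace T of dimension at most m - 2, then v W lies in T; the
orthogonal of T for the form (x, y) |-> lam (x y), with lam a nonzero
F_q-functional on F, has dimension at least 2, so it contains independent b1
and b2, and lam vanishes on v (b1 W + b2 W) = v F^(2l), which forces v = 0.

The rest is duality and counting. The code C_Phi and the row space D_Phi of [H0
| Z] are orthogonal and of complementary dimension ([dual_pair]), so each is
the kernel of a generator matrix of the other. A word of D_Phi extends a word
of D0, so d(D_Phi) >= m - 1; generalized rank weights compare for the same
reason, since deleting the last s coordinates embeds D_Phi in D0 and does not
enlarge supports. An intersection of U_Phi with an h-dimensional F-space in
rank h + 1 would produce a word of weight at most h + 1 in the dual code D_Phi
([scattered_of_dual_distance]); so U_Phi is (m - 3)-scattered. Likewise, a
dependency over F_q among the columns of a generator matrix of C_Phi would be a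
word of D_Phi of weight 1. Upper bounds on minimum distances come from
comparing F_q-dimensions: a large code meets T^n nontrivially when T is a large
enough subspace of F ([exists_small_word]). Finally C_Phi has a word of weight
1 exactly when the columns of [H0 | Z] are F_q-dependent, that is, when the
columns of Z are dependent modulo W ([CPhi_weight_gt1P], [Ebar_dimP]). *)

(** * Scattered systems of maximum rank *)

Lemma qscaleE (K : fieldType) (L : fieldExtType K) k (a : K) (v : qvec L k) :
  a *: v = (a%:A : L) *: (v : 'cV[L]_k) :> 'cV[L]_k.
Proof. by apply/matrixP=> i j; rewrite !mxE mulr_algl. Qed.

Lemma dim_qvec (K : fieldType) (L : fieldExtType K) k :
  \dim {:qvec L k} = (k * \dim {:L})%N.
Proof.
by rewrite !dimvf (_ : dim (qvec L k) = (#|'I_k| * dim L)%N) // card_ord.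
Qed.

Section Scattered.
Variables (K : finFieldType) (L : fieldExtType K).

(** A function on [qvec], so that F_q-linearity can be declared for it. *)
Definition scale_qvec k (b : L) (v : qvec L k) : qvec L k :=
  b *: (v : 'cV[L]_k).

Fact scale_qvec_is_linear k b : linear (@scale_qvec k b).
Proof.
move=> a u v; apply/matrixP=> i j.
by rewrite !mxE mulrDr -scalerAr.
Qed.
HB.instance Definition _ k b := GRing.isLinear.Build K (qvec L k) (qvec L k)
  *:%R (@scale_qvec k b) (@scale_qvec_is_linear k b).

Lemma scale_qvec_eq0 k b (v : qvec L k) :
  (scale_qvec b v == 0) = (b == 0) || (v == 0).
Proof. exact: (scaler_eq0 b (v : 'cV[L]_k)). Qed.

(** The F-line through a nonzero vector of a 1-scattered system meets the
    system in just an F_q-line. *)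
Lemma scattered_ratio k n (U : {vspace qvec L k}) (u : qvec L k) (a : L) :
  scattered_system n 1 U -> u \in U -> u != 0 -> scale_qvec a u \in U ->
  exists c : K, a = c%:A.
Proof.
move=> [_ scU] Uu u0 Uau.
have := scU <[u : 'cV[L]_k]>%VS; rewrite dim_vline u0 => /(_ erefl) le1.
have sub : (<[u]> <= U :&: Fq_of <[u : 'cV[L]_k]>)%VS.
  by rewrite -memvE memv_cap Uu mem_Fq_of memv_line.
have /eqP eqU : <[u]>%VS == (U :&: Fq_of <[u : 'cV[L]_k]>)%VS.
  by rewrite eqEdim sub dim_vline u0.
have : scale_qvec a u \in <[u]>%VS.
  by rewrite eqU memv_cap Uau mem_Fq_of memvZ ?memv_line.
case/vlineP=> c; rewrite qscaleE => eq_au; exists c; apply/eqP.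
have /eqP : (a - c%:A) *: (u : 'cV[L]_k) = 0.
  by apply/eqP; rewrite scalerBl subr_eq0; apply/eqP.
by rewrite scaler_eq0 (negPf u0) orbF subr_eq0.
Qed.

(** The two summands meet trivially, by [scattered_ratio] applied to b2 / b1,
    and each has half the rank of the whole space. *)
Lemma maximum_scattered_sum l (W : {vspace qvec L (2 * l)}) (b1 b2 : L) :
  maximum_scattered W -> b1 != 0 -> b2 \notin <[b1]>%VS ->
  (linfun (scale_qvec b1) @: W + linfun (scale_qvec b2) @: W)%VS = fullv.
Proof.
move=> scW b1n0 b2n.
have b2n0 : b2 != 0 by apply: contraNneq b2n => ->; rewrite mem0v.
have dimI b : b != 0 -> \dim (linfun (@scale_qvec (2 * l) b) @: W) = \dim W.
  move=> bn0; apply/limg_dim_eq/eqP; rewrite -subv0; apply/subvP=> w.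
  rewrite memv_cap memv_ker lfunE /= scale_qvec_eq0 (negPf bn0) /=.
  by case/andP=> _; rewrite memv0.
apply/eqP; rewrite eqEdim subvf /= dim_qvec dimv_disjoint_sum; last first.
  apply/eqP; rewrite -subv0; apply/subvP=> w.
  rewrite memv_cap => /andP[/memv_imgP[w1 Ww1 ->] /memv_imgP[w2 Ww2]].
  rewrite !lfunE /= memv0 => eqw; apply: contraNT b2n => nz.
  have w2n0 : w2 != 0.
    by apply: contraNneq nz => w20; rewrite eqw w20 /scale_qvec scaler0.
  have w1E : w1 = scale_qvec (b2 / b1) w2.
    rewrite /scale_qvec mulrC -scalerA -[b2 *: _]eqw /scale_qvec scalerA.
    by rewrite mulVf // scale1r.
  have [|c cE] := scattered_ratio (a := b2 / b1) scW Ww2 w2n0.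
    by rewrite -w1E.
  by apply/vlineP; exists c; rewrite -mulr_algl -cE divfK.
by rewrite !dimI // (proj1 (proj1 scW)) -mulnA mul2n addnn.
Qed.

(** Orthogonality to T, for the form (x, y) |-> lam (x y), imposes \dim T
    linear conditions, and so leaves at least a plane when T has codimension 2. *)
Lemma orthogonal_pair (T : {vspace L}) (lam : {scalar L}) :
  (\dim T + 2 <= \dim {:L})%N ->
  exists b1 b2 : L, [/\ b1 != 0, b2 \notin <[b1]>%VS,
    forall t, t \in T -> lam (t * b1) = 0
  & forall t, t \in T -> lam (t * b2) = 0].
Proof.
move=> dimT.
pose f (b : L) : 'rV[K]_(\dim T) := \row_i lam ((vbasis T)`_i * b).
have flin : linear f.
  move=> a u v; apply/rowP=> i; rewrite !mxE mulrDr -scalerAr.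
  by rewrite linearP.
pose F : {linear L -> 'rV[K]_(\dim T)} :=
  HB.pack f (GRing.isLinear.Build K L 'rV[K]_(\dim T) *:%R f flin).
have kerP b : b \in lker (linfun F) -> forall t, t \in T -> lam (t * b) = 0.
  rewrite memv_ker lfunE /= => /eqP/rowP fb0 t /coord_vbasis ->.
  rewrite mulr_suml linear_sum big1 // => i _.
  rewrite -scalerAl linearZ /=; have := fb0 i; rewrite !mxE => ->.
  by rewrite mulr0.
have dimk : (1 < \dim (lker (linfun F)))%N.
  have := limg_ker_dim (linfun F) fullv; rewrite capfv => dimE.
  have : (\dim (limg (linfun F)) <= \dim T)%N.
    by rewrite (leq_trans (dimvS (subvf _))) // dimvf /dim /= mul1n.
  by rewrite -(leq_add2l (\dim (lker (linfun F)))) dimE => /(leq_trans dimT);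
     rewrite addnC leq_add2r.
pose b1 := vpick (lker (linfun F)).
have b1n0 : b1 != 0 by rewrite vpick0 -dimv_eq0 -lt0n ltnW.
have /subvPn[b2 kb2 nb2] : ~~ (lker (linfun F) <= <[b1]>)%VS.
  by apply: contraL dimk => /dimvS; rewrite dim_vline b1n0 -leqNgt.
by exists b1, b2; split=> //; apply: kerP => //; apply: memv_pick.
Qed.

Lemma nonzero_functional : exists lam : {scalar L}, lam 1 != 0.
Proof.
pose X : 1.-tuple L := [tuple 1].
have fX : free X by rewrite free_cons span_nil memv0 oner_neq0 nil_free.
exists (coord X 0).
by have /= -> := coord_free 0 0 fX; rewrite oner_eq0.
Qed.

(** A nonzero F-linear form takes on W values that span at least m - 1
    dimensions: otherwise [orthogonal_pair] and [maximum_scattered_sum] make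
    lam vanish on all values of the form on F^(2l), which exhaust F. *)
Lemma maximum_scattered_functional l (W : {vspace qvec L (2 * l)})
    (v : 'rV[L]_(2 * l)) (T : {vspace L}) :
  maximum_scattered W -> (\dim T + 2 <= \dim {:L})%N ->
  (forall w : 'cV[L]_(2 * l), (w : qvec L (2 * l)) \in W ->
    (v *m w) 0 0 \in T) -> v = 0.
Proof.
move=> scW dimT vWT.
have [lam lam1] := nonzero_functional.
have [b1 [b2 [b1n0 b2n lam_b1 lam_b2]]] := orthogonal_pair lam dimT.
have lam0 (y : 'cV[L]_(2 * l)) : lam ((v *m y) 0 0) = 0.
  have : (y : qvec L (2 * l)) \in fullv by rewrite memvf.
  rewrite -(maximum_scattered_sum scW b1n0 b2n) => /memv_addP[y1].
  case/memv_imgP=> w1 Ww1 -> [y2 /memv_imgP[w2 Ww2 ->] ->].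
  rewrite !lfunE /= /scale_qvec mulmxDr -!scalemxAr !mxE linearD /=.
  have := lam_b1 _ (vWT _ Ww1); have := lam_b2 _ (vWT _ Ww2).
  by rewrite !mxE ![b1 * _]mulrC ![b2 * _]mulrC => -> ->; rewrite addr0.
apply/rowP=> i; rewrite mxE; apply: contraNeq lam1 => vi0.
(* a nonzero form v takes the value 1, where lam does not vanish *)
have := lam0 ((v 0 i)^-1 *: delta_mx i 0).
rewrite -scalemxAr !mxE (bigD1 i) //= big1 => [|j ji]; last first.
  by rewrite !mxE (negPf ji) mulr0.
by rewrite !mxE !eqxx mulr1 addr0 mulVf // => ->.
Qed.
End Scattered.

(** * Families of vectors and generator matrices *)

Lemma exists_subv (F : fieldType) (V : vectType F) (T : {vspace V}) t :
  (t <= \dim T)%N -> exists2 S : {vspace V}, (S <= T)%VS & \dim S = t.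
Proof.
move=> tT; exists <<take t (vbasis T)>>%VS.
  by apply/span_subvP=> x /mem_take; apply: vbasis_mem.
have := basis_free (vbasisP T); rewrite -{1}(cat_take_drop t (vbasis T)).
move/catl_free; rewrite /free => /eqP ->.
by rewrite size_takel // size_tuple.
Qed.

Section Families.
Variables (F : fieldType) (V : vectType F) (n : nat) (f : 'I_n -> V).

Lemma nth_family (j : 'I_n) : [seq f i | i <- enum 'I_n]`_j = f j.
Proof. by rewrite (nth_map j) ?size_enum_ord // nth_ord_enum. Qed.

Lemma span_familyP v :
  v \in <<[seq f j | j <- enum 'I_n]>>%VS <->
  exists c : 'cV[F]_n, v = \sum_j c j 0 *: f j.
Proof.
have sz : size [seq f j | j <- enum 'I_n] == n.
  by rewrite size_map size_enum_ord.
split=> [|[c ->]]; last first.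
  by apply: memv_suml => j _; rewrite memvZ // memv_span ?map_f ?mem_enum.
move/(@coord_span _ _ _ (Tuple sz)) => vE.
exists (\col_j coord (Tuple sz) j v); rewrite {1}vE.
by apply: eq_bigr => j _; rewrite mxE nth_family.
Qed.

Lemma free_familyP :
  free [seq f j | j <- enum 'I_n] <->
  (forall c : 'cV[F]_n, \sum_j c j 0 *: f j = 0 -> c = 0).
Proof.
have sz : size [seq f j | j <- enum 'I_n] == n.
  by rewrite size_map size_enum_ord.
split=> [/(@freeP _ _ _ (Tuple sz)) fr c c0|fr].
  apply/colP=> j; rewrite mxE; apply: (fr (c^~ 0)).
  by rewrite -[RHS]c0; apply: eq_bigr => i _; rewrite nth_family.
apply/(@freeP _ _ _ (Tuple sz)) => c c0 j.
have /colP/(_ j) : \col_i c i = 0.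
  by apply: fr; rewrite -[RHS]c0; apply: eq_bigr => i _; rewrite mxE nth_family.
by rewrite !mxE.
Qed.
End Families.

Section RowCode.
Variables (K : finFieldType) (L : fieldExtType K).

Lemma sum_rows r n (A : 'M[L]_(r, n)) (c : 'cV[L]_r) :
  \sum_j c j 0 *: row j A = c^T *m A.
Proof. by rewrite mulmx_sum_row; apply: eq_bigr => j _; rewrite mxE. Qed.

Lemma mem_row_code r n (A : 'M[L]_(r, n)) (y : 'rV[L]_n) :
  (y \in row_code A) = (y <= A)%MS.
Proof.
apply/idP/submxP=> [/span_familyP[c ->]|[v ->]].
  by exists c^T; rewrite sum_rows.
by apply/span_familyP; exists v^T; rewrite sum_rows trmxK.
Qed.

Lemma free_rows r n (A : 'M[L]_(r, n)) :
  free [seq row i A | i <- enum 'I_r] = row_free A.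
Proof.
apply/idP/idP=> [/free_familyP frA|frA].
  apply/inj_row_free=> v v0.
  have : v^T = 0 by apply: frA; rewrite sum_rows trmxK.
  by move/(canRL (@trmxK _ _ _)); rewrite trmx0.
apply/free_familyP=> c; rewrite sum_rows -(mul0mx _ A) => /(row_free_inj frA).
by move/(canRL (@trmxK _ _ _)); rewrite trmx0.
Qed.

Lemma generator_row_code r n (A : 'M[L]_(r, n)) :
  row_free A -> generator_matrix (row_code A) A.
Proof. by move=> frA; rewrite /generator_matrix /basis_of eqxx free_rows. Qed.

Lemma generator_dim r n (C : {vspace 'rV[L]_n}) (A : 'M[L]_(r, n)) :
  generator_matrix C A -> \dim C = r.
Proof.
by case/andP=> /eqP <- /eqP ->; rewrite size_map size_enum_ord.
Qed.

Lemma mem_dual_row_code r n (A : 'M[L]_(r, n)) (y : 'rV[L]_n) :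
  (y \in dual_code (row_code A)) = (y *m A^T == 0).
Proof.
apply/idP/eqP=> [/mem_dual_code yA|yA].
  apply/trmx_inj; rewrite trmx_mul trmxK trmx0; apply/row_matrixP=> i.
  by rewrite row_mul row0 yA // mem_row_code row_sub.
apply/mem_dual_code=> x; rewrite mem_row_code => /submxP[v ->].
by rewrite -mulmxA -(trmxK A) -trmx_mul yA trmx0 mulmx0.
Qed.

(** Orthogonality puts the row space of A inside the kernel of B^T, and the two
    have the same dimension. *)
Lemma dual_pair a b n (A : 'M[L]_(a, n)) (B : 'M[L]_(b, n)) :
  row_free A -> row_free B -> (a + b = n)%N -> A *m B^T = 0 ->
  forall y : 'rV[L]_n, (y <= A)%MS = (y *m B^T == 0).
Proof.
move=> frA frB abn AB0 y; rewrite -sub_kermx.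
have sAk : (A <= kermx B^T)%MS by rewrite sub_kermx AB0.
have /geq_leqif := mxrank_leqif_eq sAk.
rewrite mxrank_ker mxrank_tr (eqP frA) (eqP frB) leq_subLR addnC abn leqnn.
move/esym=> eqk.
by rewrite (eqmxP eqk).
Qed.

Lemma nondegenerate_of_generator r n (C : {vspace 'rV[L]_n})
    (A : 'M[L]_(r, n)) :
  generator_matrix C A -> free (qcols A) -> nondegenerate_code C.
Proof.
by move=> genA; move: A genA (generator_dim genA) => A + eqr;
   case: _ / eqr A => A; exists A.
Qed.

(** Turns span and independence of columns over F_q into matrix equations. *)
Lemma sum_qcols r n (A : 'M[L]_(r, n)) (c : 'cV[K]_n) :
  \sum_j c j 0 *: (col j A : qvec L r) = A *m map_mx (in_alg L) c.
Proof.
apply/trmx_inj; rewrite trmx_mul mulmx_sum_row linear_sum.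
apply: eq_bigr => j _; rewrite qscaleE linearZ /= !mxE.
by congr (_ *: _); rewrite tr_col.
Qed.

Lemma span_qcolsP r n (A : 'M[L]_(r, n)) (w : qvec L r) :
  w \in <<qcols A>>%VS <->
  exists c : 'cV[K]_n, w = A *m map_mx (in_alg L) c.
Proof.
by split=> [/span_familyP|] [c ->]; [|apply/span_familyP]; exists c;
   rewrite sum_qcols.
Qed.

Lemma free_qcolsP r n (A : 'M[L]_(r, n)) :
  free (qcols A) <->
  (forall c : 'cV[K]_n, A *m map_mx (in_alg L) c = 0 -> c = 0).
Proof.
split=> [/free_familyP frA c|frA]; first by rewrite -sum_qcols; apply: frA.
by apply/free_familyP=> c; rewrite sum_qcols; apply: frA.
Qed.

(** * Rank weight and minimum distance *)

Lemma rank_weight_le n (x : 'rV[L]_n) (T : {vspace L}) :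
  (forall j, x 0 j \in T) -> (rank_weight x <= \dim T)%N.
Proof. by move=> xT; apply/dimvS/span_subvP=> _ /mapP[j _ ->]. Qed.

Lemma mem_entries n (x : 'rV[L]_n) j :
  x 0 j \in <<[seq x ord0 j | j <- enum 'I_n]>>%VS.
Proof. by apply/memv_span/map_f; rewrite mem_enum. Qed.

Lemma rank_weight_gt0 n (x : 'rV[L]_n) : x != 0 -> (0 < rank_weight x)%N.
Proof.
apply: contraNT; rewrite -leqNgt leqn0 dimv_eq0 => /eqP x0.
by apply/eqP/rowP=> j; have := mem_entries x j; rewrite x0 memv0 mxE => /eqP.
Qed.

Lemma rank_weight1 n (x : 'rV[L]_n) : (rank_weight x <= 1)%N ->
  exists (a : L) (c : 'cV[K]_n), x = a *: (map_mx (in_alg L) c)^T.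
Proof.
move=> wx; set T := <<[seq x ord0 j | j <- enum 'I_n]>>%VS.
have sT : (T <= <[vpick T]>)%VS.
  have [->|T0] := eqVneq T 0%VS; first exact: sub0v.
  have := T0; rewrite -vpick0 => p0.
  have sub : (<[vpick T]> <= T)%VS by rewrite -memvE memv_pick.
  have : (<[vpick T]> == T)%VS by rewrite eqEdim sub dim_vline p0.
  by move/eqP=> {1}<-.
have cP j : exists c : K, x 0 j = c *: vpick T.
  by apply/vlineP/(subvP sT)/mem_entries.
have /fin_all_exists[c cE] := cP.
exists (vpick T), (\col_j c j); apply/rowP=> j.
by rewrite cE !mxE mulr_algr.
Qed.

(** The entries of the product are F_q-combinations of the t entries of a. *)
Lemma rank_weight_comb t n (a : 'rV[L]_t) (c : 'M[K]_(t, n)) :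
  (rank_weight (a *m map_mx (in_alg L) c) <= t)%N.
Proof.
apply: (@leq_trans (\dim <<[seq a ord0 i | i <- enum 'I_t]>>%VS)).
  apply: rank_weight_le => j; rewrite mxE; apply: memv_suml => i _.
  by rewrite mxE mulr_algr memvZ // mem_entries.
by rewrite (leq_trans (dim_span _)) // size_map size_enum_ord.
Qed.

Lemma rank_weight_Fq n (c : 'cV[K]_n) :
  (rank_weight (map_mx (in_alg L) c)^T <= 1)%N.
Proof.
by have := rank_weight_comb (1 : 'rV[L]_1) c^T; rewrite mul1mx map_trmx.
Qed.

Lemma min_distance_eq n (C : {vspace 'rV[L]_n}) d :
  (exists x, [/\ x \in C, x != 0 & (rank_weight x <= d)%N]) ->
  (forall x, x \in C -> x != 0 -> (d <= rank_weight x)%N) ->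
  min_distance C = d.
Proof.
move=> [x [Cx x0 wx]] ge_d; rewrite /min_distance.
set P : nat -> Prop := fun w => _.
have [|[y [Cy y0 yE]] le_min] := @minnatP P; first by exists (rank_weight x), x.
apply/eqP; rewrite eqn_leq -{2}yE ge_d // andbT (leq_trans _ wx) // le_min //.
by exists x.
Qed.

(** Singleton-type bound: the words of C whose entries all lie in a
    t-dimensional T form the kernel of the F_q-linear map of C to (F / T)^n,
    which cannot be injective when C has larger F_q-dimension than n (m - t). *)
Lemma exists_small_word n (C : {vspace 'rV[L]_n}) t :
  (t <= \dim {:L})%N ->
  (n * \dim {:L} < \dim C * \dim {:L} + n * t)%N ->
  exists x, [/\ x \in C, x != 0 & (rank_weight x <= t)%N].
Proof.
move=> tm big; have [T _ dimT] := exists_subv tm.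
pose word (v : qvec L (\dim C)) : 'rV[L]_n :=
  \sum_i (v : 'cV[L]_(\dim C)) i 0 *: (vbasis C)`_i.
pose f v := [ffun j => vpi T (word v 0 j)] : {ffun 'I_n -> vquot T}.
have flin : linear f.
  move=> a u v; apply/ffunP=> j; rewrite !ffunE -linearP; congr vpi.
  rewrite !summxE scaler_sumr -big_split /=; apply: eq_bigr => i _.
  by rewrite !mxE mulrDl scalerAl.
pose g : {linear qvec L (\dim C) -> {ffun 'I_n -> vquot T}} :=
  HB.pack f (GRing.isLinear.Build K _ _ *:%R f flin).
have dimq : \dim {:{ffun 'I_n -> vquot T}} = (n * (\dim {:L} - t))%N.
  rewrite dimvf (_ : dim _ = (#|'I_n| * dim (vquot T))%N) // card_ord.
  by rewrite -dimvf /vquot dimvf (_ : dim _ = \dim (T^C)%VS) // dimv_compl dimT.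
have : lker (linfun g) != 0%VS.
  rewrite -dimv_eq0; apply: contraTneq big => ker0.
  have := limg_ker_dim (linfun g) fullv; rewrite capfv ker0 add0n dim_qvec.
  have := dimvS (subvf (limg (linfun g))); rewrite dimq => + dimE.
  by rewrite dimE mulnBr -leqNgt leq_subRL ?leq_mul2l ?tm ?orbT // addnC.
rewrite -vpick0; set v := vpick _ => v0.
have : v \in lker (linfun g) by apply: memv_pick.
rewrite memv_ker lfunE /= => /eqP/ffunP fv0.
exists (word v); split.
- apply: memv_suml => i _.
  by rewrite memvZ // vbasis_mem // mem_nth ?size_tuple.
- apply: contraNneq v0 => wv0; apply/eqP/matrixP=> i j; rewrite (ord1 j) !mxE.
  have /freeP fr := basis_free (vbasisP C).
  exact: (fr (fun i => (v : 'cV[L]_(\dim C)) i 0)).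
rewrite -dimT; apply: rank_weight_le => j.
have := fv0 j; rewrite !ffunE -[word v 0 j]subr0 => e0.
by apply/vpi_eq; rewrite subr0 in e0 *; rewrite e0 linear0.
Qed.

(** The defect vanishes when e = m + 1 - d is the ceiling of m r / n, which the
    last hypothesis says without division. *)
Lemma quasi_MRD_eq n (C : {vspace 'rV[L]_n}) e : (\dim {:L} < n)%N ->
  (min_distance C + e = \dim {:L} + 1)%N -> (0 < e)%N ->
  (e.-1 * n < \dim {:L} * \dim C <= e * n)%N -> quasi_MRD C.
Proof.
move=> mn de e0 /andP[lo hi]; split=> //; rewrite /Rdef.
have n0 : 0 < n%:R :> rat by rewrite ltr0n (leq_trans _ mn).
have -> : Num.ceil ((\dim {:L} * \dim C)%:R / n%:R : rat) = e%:Z.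
  apply/ceil_def; rewrite ltr_pdivlMr // ler_pdivrMr //.
  rewrite -[e%:Z%:~R]/(e%:R) -natrM ler_nat hi andbT -(prednK e0).
  by rewrite -addn1 PoszD addrK -[e.-1%:Z%:~R]/(e.-1%:R) -natrM ltr_nat.
lia.
Qed.
End RowCode.

(** * Scattered systems from the distance of the dual code *)

Section DualDistance.
Variables (K : finFieldType) (L : fieldExtType K).

(** Suppose that h + 1 independent vectors A c_i of the system lie in H. They
    satisfy an F-linear relation with coefficients a_i, so the sum of the a_i
    c_i is a word of the dual code; it has rank weight at most h + 1, and it is
    nonzero because the c_i remain independent over F. *)
Lemma scattered_of_dual_distance k n h (A : 'M[L]_(k, n)) :
  (forall y : 'rV[L]_n, y *m A^T = 0 -> y != 0 -> (h.+1 < rank_weight y)%N) ->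
  forall H : {vspace 'cV[L]_k}, \dim H = h ->
  (\dim (<<qcols A>> :&: Fq_of H) <= h)%N.
Proof.
move=> dA H dimH; rewrite leqNgt; apply/negP=> /exists_subv[Y sY dimY].
have bY (i : 'I_(\dim Y)) : (vbasis Y)`_i \in Y.
  by rewrite vbasis_mem // mem_nth ?size_tuple.
have /fin_all_exists[c cE] (i : 'I_(\dim Y)) : exists c : 'cV[K]_n,
    (vbasis Y)`_i = A *m map_mx (in_alg L) c.
  by apply/span_qcolsP; have /(subvP sY) := bY i; rewrite memv_cap => /andP[].
pose b (i : 'I_(\dim Y)) : 'cV[L]_k := (vbasis Y)`_i.
have bH i : b i \in H.
  by rewrite -mem_Fq_of; have /(subvP sY) := bY i; rewrite memv_cap => /andP[].
have [a a0 ab] : exists2 a : 'cV[L]_(\dim Y),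
    a != 0 & \sum_(i < \dim Y) a i 0 *: b i = 0.
  case: (pselect (forall a : 'cV[L]_(\dim Y),
      \sum_(i < \dim Y) a i 0 *: b i = 0 -> a = 0)) => [|]; last first.
    by move/existsNP=> [a /not_implyP[ab /eqP a0]]; exists a.
  move/free_familyP; rewrite /free size_map size_enum_ord => /eqP dimb.
  suff /dimvS : (<<[seq b i | i <- enum 'I_(\dim Y)]>> <= H)%VS.
    by rewrite dimb dimH => leYh; have := ltnn h; rewrite -dimY leYh.
  by apply/span_subvP=> _ /mapP[i _ ->]; apply: bH.
pose cM : 'M[K]_(\dim Y, n) := \matrix_(i, j) c i j 0.
have cMc (v : 'rV[K]_(\dim Y)) : (v *m cM)^T = \sum_i v 0 i *: c i.
  apply/colP=> j; rewrite !mxE summxE; apply: eq_bigr => i _.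
  by rewrite !mxE.
have frc : row_free cM.
  apply/inj_row_free=> v v0.
  have fr := basis_free (vbasisP Y).
  apply/rowP=> i; rewrite mxE; move/freeP: fr => fr; apply: (fr (v 0)).
  have sum0 : \sum_j v 0 j *: c j = 0.
    by rewrite -cMc v0 trmx0.
  transitivity (A *m map_mx (in_alg L) (\sum_j v 0 j *: c j)); last first.
    by rewrite sum0 map_mx0 mulmx0.
  rewrite map_mx_sum mulmx_sumr; apply: eq_bigr => j _.
  rewrite cE qscaleE; apply/colP=> i'.
  by rewrite map_mxZ -scalemxAr.
pose y := a^T *m map_mx (in_alg L) cM.
have := rank_weight_comb a^T cM; rewrite -/y dimY leqNgt => /negP; apply.
apply: dA.
  apply/trmx_inj; rewrite trmx_mul !trmxK trmx0 -[RHS]ab trmx_mul trmxK mulmxA.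
  apply/colP=> i; rewrite mxE summxE; apply: eq_bigr => j _.
  rewrite /b cE !mxE mulrC; congr (_ * _); apply: eq_bigr => j' _.
  by rewrite !mxE.
apply: contraNneq a0 => y0; apply/eqP/trmx_inj.
apply: (row_free_inj (A := map_mx (in_alg L) cM)).
  by rewrite row_free_map.
by rewrite -/y y0 trmx0 mul0mx.
Qed.

(** * Supports and generalized rank weights *)

Lemma RsuppP n (x : 'rV[L]_n) (U : {vspace 'rV[K]_n}) :
  (Rsupp x <= U)%VS <-> (forall i, row i (expand x) \in U).
Proof.
split=> [/subvP sU i|xU]; first by apply/sU/memv_span/map_f; rewrite mem_enum.
by apply/span_subvP=> _ /mapP[i _ ->].
Qed.

(** Scaling by an element of F multiplies the expansion on the left by a matrix
    over F_q, hence cannot enlarge the support. *)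
Lemma expandZ n (a : L) (x : 'rV[L]_n) :
  expand (a *: x) =
  \matrix_(i, k) coord (vbasis {:L}) i (a * (vbasis {:L})`_k) *m expand x.
Proof.
apply/matrixP=> i j; rewrite !mxE.
rewrite {1}(coord_vbasis (memvf (x 0 j))) mulr_sumr linear_sum.
by apply: eq_bigr => k _; rewrite -scalerAr linearZ !mxE /= [LHS]mulrC.
Qed.

(** This makes the support of V independent of the basis in its definition. *)
Lemma Rsuppv_subP n (V : {vspace 'rV[L]_n}) (U : {vspace 'rV[K]_n}) :
  (Rsuppv V <= U)%VS <-> (forall x, x \in V -> (Rsupp x <= U)%VS).
Proof.
rewrite /Rsuppv; split=> [sVU x Vx|sVU]; last first.
  rewrite big_seq; apply: (big_ind (fun X => (X <= U)%VS)) => [|X Y sX sY|y Vy].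
  - exact: sub0v.
  - by rewrite subv_add sX.
  - exact/sVU/vbasis_mem.
rewrite (coord_vbasis Vx).
apply: (big_ind (fun y => (Rsupp y <= U)%VS))
    => [|y z /RsuppP Uy /RsuppP Uz|j _].
- apply/RsuppP=> i; rewrite (_ : row i _ = 0) ?mem0v //.
  by apply/rowP=> j; rewrite !mxE linear0.
- apply/RsuppP=> i; rewrite (_ : row i _ = row i (expand y) + row i (expand z)).
    by rewrite memvD.
  by apply/rowP=> j; rewrite !mxE linearD.
have /RsuppP Uj : (Rsupp (vbasis V)`_j <= U)%VS.
  apply: subv_trans sVU.
  by rewrite (big_rem (vbasis V)`_j) ?addvSl // mem_nth ?size_tuple.
apply/RsuppP=> i; rewrite expandZ row_mul mulmx_sum_row.
by apply: memv_suml => k _; rewrite memvZ.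
Qed.

Lemma Rsupp_lsubmx n s (x : 'rV[L]_(n + s)) :
  (Rsupp (lsubmx x) <= linfun (@lsubmx K 1 n s) @: Rsupp x)%VS.
Proof.
apply/RsuppP=> i; apply/memv_imgP; exists (row i (expand x)).
  by apply/memv_span/map_f; rewrite mem_enum.
by rewrite lfunE; apply/rowP=> j; rewrite !mxE.
Qed.

(** Deleting coordinates maps an i-dimensional subspace of D onto one of C, and
    its support onto a space containing that of the image. *)
Lemma gen_rank_weight_le n s (C : {vspace 'rV[L]_n})
    (D : {vspace 'rV[L]_(n + s)}) i :
  (forall y, y \in D -> lsubmx y \in C) ->
  (forall y, y \in D -> lsubmx y = 0 -> y = 0) ->
  (i <= \dim D)%N -> (gen_rank_weight i C <= gen_rank_weight i D)%N.
Proof.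
move=> DC injD iD; rewrite /gen_rank_weight.
set PC : nat -> Prop := fun w => _; set PD : nat -> Prop := fun w => _.
have [|[V [sVD dimV <-]] _] := @minnatP PD.
  by have [V sVD dimV] := exists_subv iD; exists (\dim (Rsuppv V)), V.
pose V' := (linfun (@lsubmx L 1 n s) @: V)%VS.
have PV' : PC (\dim (Rsuppv V')).
  exists V'; split=> //.
    by apply/subvP=> _ /memv_imgP[y Vy ->]; rewrite lfunE; apply/DC/(subvP sVD).
  rewrite -dimV; apply/limg_dim_eq/eqP; rewrite -subv0; apply/subvP=> y.
  rewrite memv_cap memv_ker lfunE memv0 => /andP[Vy /eqP y0].
  by apply/eqP/injD => //; apply: (subvP sVD).
have [|_ le_min] := @minnatP PC; first by exists (\dim (Rsuppv V')).
apply: leq_trans (le_min _ PV') _.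
suff /dimvS/leq_trans : (Rsuppv V' <= linfun (@lsubmx K 1 n s) @: Rsuppv V)%VS.
  have := limg_ker_dim (linfun (@lsubmx K 1 n s)) (Rsuppv V).
  by move=> <-; apply; rewrite leq_addl.
apply/Rsuppv_subP=> _ /memv_imgP[y Vy ->]; rewrite lfunE /=.
apply: subv_trans (Rsupp_lsubmx y) _; apply: limgS.
by move: y Vy; apply/Rsuppv_subP.
Qed.
End DualDistance.

(** * Arithmetic of the parameters *)

Section Arithmetic.
Variables (m l s : nat).
Hypothesis hm : (5 <= m)%N.

Lemma dims_add : (2 * l + l * (m - 2) = l * m)%N.
Proof. by rewrite mulnC -mulnDr subnKC // (leq_trans _ hm). Qed.

Lemma scatter_distance : (m - 3).+2 = (m - 1)%N.
Proof. by lia. Qed.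

(** Used to keep truncated subtraction out of the nonlinear goals. *)
Lemma exists_sub2 : exists p, m = (p + 2)%N.
Proof. by exists (m - 2)%N; lia. Qed.

Lemma rank_extremal : (2 * s < m - 2)%N ->
  (l * m + s = (l * (m - 2) + s) * m %/ (m - 3).+1)%N.
Proof.
have [p ->] := exists_sub2; rewrite addnK => s2.
have -> : (p + 2 - 3).+1 = p by lia.
have -> : ((l * p + s) * (p + 2) = (l * (p + 2) + s) * p + 2 * s)%N by nia.
by rewrite divnMDl ?divn_small ?addn0 //; lia.
Qed.

Lemma rank_not_maximum : (1 <= s)%N -> (2 * s < m - 2)%N ->
  ~~ ((m - 3).+1 %| (l * (m - 2) + s) * m)%N.
Proof.
have [p ->] := exists_sub2; rewrite addnK => s1 s2.
have -> : (p + 2 - 3).+1 = p by lia.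
have -> : ((l * p + s) * (p + 2) = (l * (p + 2) + s) * p + 2 * s)%N by nia.
rewrite dvdn_addr; last exact: dvdn_mull.
by rewrite gtnNdvd // muln_gt0.
Qed.

Lemma length_gt : (1 <= l)%N -> (1 <= s)%N -> (m < l * m + s)%N.
Proof. by move=> l1 s1; have := leq_pmull m l1; lia. Qed.

Lemma count_DPhi : (1 <= l)%N -> (2 * s < m - 2)%N ->
  ((l * m + s) * m < 2 * l * m + (l * m + s) * (m - 1))%N.
Proof. by have [p ->] := exists_sub2 => l1 s2; nia. Qed.

Lemma ceil_DPhi : (1 <= l)%N -> (2 * s < m - 2)%N ->
  (2.-1 * (l * m + s) < m * (2 * l) <= 2 * (l * m + s))%N.
Proof. by move=> l1 s2; apply/andP; split; nia. Qed.

Lemma count_CPhi : (1 <= s)%N ->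
  ((l * m + s) * m < (l * (m - 2) + s) * m + (l * m + s) * 2)%N.
Proof. by have [p ->] := exists_sub2 => s1; rewrite addnK; nia. Qed.

Lemma ceil_CPhi : (1 <= l)%N -> (1 <= s)%N -> (2 * s < m - 2)%N ->
  ((m - 1).-1 * (l * m + s) < m * (l * (m - 2) + s)
    <= (m - 1) * (l * m + s))%N.
Proof.
move=> l1 s1 s2; have sl : (s <= l * m)%N by nia.
have [p mp] := exists_sub2; rewrite mp in sl *; rewrite addnK.
have -> : (p + 2 - 1 = p.+1)%N by lia.
by apply/andP; split=> /=; nia.
Qed.

End Arithmetic.

(** * The extended codes *)

(** The columns (g_j, phi g_j) and (0, e_i) of the extended generator matrix
    are the images of generators of U0 and of F_q^s. *)
Lemma UphiE (K : finFieldType) (L : fieldExtType K) k0 n0 s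
    (G0 : 'M[L]_(k0, n0)) (phi : 'Hom(subvs_of (U0 G0), qvec L s)) :
  Uphi phi = <<qcols (GPhi phi)>>%VS.
Proof.
have phiE (c : 'cV[K]_n0) :
    phi (vsproj (U0 G0) (G0 *m map_mx (in_alg L) c)) =
    Phi phi *m map_mx (in_alg L) c.
  rewrite -!sum_qcols !linear_sum; apply: eq_bigr => j _.
  rewrite !linearZ; congr (_ *: _).
  by apply/colP=> i; rewrite !mxE.
have GPhiE (c : 'cV[K]_(n0 + s)) : GPhi phi *m map_mx (in_alg L) c =
    col_mx (G0 *m map_mx (in_alg L) (usubmx c))
      (Phi phi *m map_mx (in_alg L) (usubmx c) + map_mx (in_alg L) (dsubmx c)).
  rewrite -{1}[c]vsubmxK map_col_mx /GPhi mul_block_col.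
  by rewrite mul0mx addr0 mul1mx.
apply/vspaceP=> v; apply/idP/idP.
  case/mem_Uphi=> u [a ->]; have /span_qcolsP[c cE] := subvsP u.
  apply/span_qcolsP; exists (col_mx c a).
  by rewrite GPhiE col_mxKu col_mxKd -phiE -cE vsvalK.
case/span_qcolsP=> c ->; apply/mem_Uphi.
exists (vsproj (U0 G0) (G0 *m map_mx (in_alg L) (usubmx c))), (dsubmx c).
by rewrite vsprojK ?GPhiE ?phiE //; apply/span_qcolsP; exists (usubmx c).
Qed.

Section Construction.
Variables (K : finFieldType) (L : fieldExtType K) (l s : nat).
Local Notation m := (\dim {:L}).
Variables (W : {vspace qvec L (2 * l)}).
Hypothesis hm : (5 <= m)%N.
Hypothesis hW : maximum_scattered W.
Variable H0 : 'M[L]_(2 * l, l * m).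
Hypothesis hH0 : basis_of W (qcols H0).
Variable G0 : 'M[L]_(l * (m - 2), l * m).
Hypothesis hG0 : generator_matrix (dual_code (row_code H0)) G0.
Variable phi : 'Hom(subvs_of (U0 G0), qvec L s).

Local Notation Z := (Zmat phi H0).
Local Notation HZ := (row_mx H0 Z).

Lemma D0_word_eq0 (v : 'rV[L]_(2 * l)) (T : {vspace L}) :
  (\dim T + 2 <= m)%N -> (forall j, (v *m H0) 0 j \in T) -> v = 0.
Proof.
move=> dimT vH0; apply: (maximum_scattered_functional hW dimT) => w.
rewrite -(span_basis hH0) => /span_qcolsP[c ->].
rewrite mulmxA mxE; apply: memv_suml => j _.
by rewrite [X in _ * X]mxE mulr_algr memvZ ?vH0.
Qed.

Lemma H0_row_free : row_free H0.
Proof.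
apply/inj_row_free=> v vH0; apply: (@D0_word_eq0 _ 0%VS).
  by rewrite dimv0 (leq_trans _ hm).
by move=> j; rewrite vH0 mxE mem0v.
Qed.

Lemma G0_row_free : row_free G0.
Proof. by rewrite -free_rows (basis_free hG0). Qed.

Lemma G0_orthogonal : G0 *m H0^T = 0.
Proof.
apply/row_matrixP=> i; rewrite row_mul row0; apply/eqP.
rewrite -mem_dual_row_code; apply: (basis_mem hG0).
by apply/map_f; rewrite mem_enum.
Qed.

(** The entries of v H0 are among those of v [H0 | Z]. *)
Lemma HZ_word_weight (v : 'rV[L]_(2 * l)) :
  v *m HZ != 0 -> (m - 1 <= rank_weight (v *m HZ))%N.
Proof.
apply: contra_neqT; rewrite -ltnNge => ltw.
have -> : v = 0; last by rewrite mul0mx.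
apply: (@D0_word_eq0 _
    <<[seq (v *m HZ) ord0 j | j <- enum 'I_(l * m + s)]>>%VS).
  by move: ltw; rewrite ltn_subRL add1n addn2.
move=> j; have := mem_entries (v *m HZ) (lshift s j).
by rewrite mul_mx_row row_mxEl.
Qed.

Lemma HZ_row_free : row_free HZ.
Proof.
apply/inj_row_free=> v; rewrite mul_mx_row -row_mx0 => /eq_row_mx[vH0 _].
apply: (row_free_inj H0_row_free).
by rewrite vH0 mul0mx.
Qed.

Lemma GPhi_row_free : row_free (GPhi phi).
Proof.
apply/inj_row_free=> v; rewrite -[v]hsubmxK /GPhi mul_row_block.
rewrite mulmx0 add0r mulmx1 -[X in _ = X -> _]row_mx0 => /eq_row_mx[+ v2].
rewrite v2 mul0mx addr0 -(mul0mx _ G0) => /(row_free_inj G0_row_free) ->.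
by rewrite row_mx0.
Qed.

Lemma GPhi_orthogonal : GPhi phi *m HZ^T = 0.
Proof.
rewrite tr_row_mx /GPhi mul_block_col G0_orthogonal mul0mx addr0 mul1mx.
by rewrite /Zmat linearN /= trmx_mul trmxK subrr col_mx0.
Qed.

Lemma mem_CPhi y : (y \in CPhi phi) = (y *m HZ^T == 0).
Proof.
rewrite /CPhi mem_row_code.
apply: (dual_pair GPhi_row_free HZ_row_free _ GPhi_orthogonal).
by rewrite addnAC [X in (X + s)%N]addnC dims_add.
Qed.

Lemma mem_DPhi y : (y \in DPhi phi) = (y <= HZ)%MS.
Proof.
rewrite /DPhi mem_dual_row_code.
rewrite (dual_pair HZ_row_free GPhi_row_free) ?addnA ?dims_add //.
by rewrite -[HZ]trmxK -trmx_mul GPhi_orthogonal trmx0.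
Qed.

Lemma DPhiE : DPhi phi = row_code HZ.
Proof. by apply/vspaceP=> y; rewrite mem_DPhi mem_row_code. Qed.

Lemma DPhi_weight y : y \in DPhi phi -> y != 0 -> (m - 1 <= rank_weight y)%N.
Proof. by rewrite mem_DPhi => /submxP[v ->]; apply: HZ_word_weight. Qed.

Lemma dim_DPhi : \dim (DPhi phi) = (2 * l)%N.
Proof. by rewrite DPhiE (generator_dim (generator_row_code HZ_row_free)). Qed.

Lemma dim_CPhi : \dim (CPhi phi) = (l * (m - 2) + s)%N.
Proof. exact: (generator_dim (generator_row_code GPhi_row_free)). Qed.

Lemma DPhi_min_distance : (1 <= l)%N -> (2 * s < m - 2)%N ->
  min_distance (DPhi phi) = (m - 1)%N.
Proof.
move=> hl hs2; apply: min_distance_eq DPhi_weight; apply: exists_small_word.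
  exact: leq_subr.
by rewrite dim_DPhi count_DPhi.
Qed.

Lemma DPhi_quasi_MRD : (1 <= l)%N -> (1 <= s)%N -> (2 * s < m - 2)%N ->
  quasi_MRD (DPhi phi).
Proof.
move=> hl hs1 hs2; apply: (@quasi_MRD_eq _ _ _ _ 2) => //.
- exact: length_gt.
- by rewrite DPhi_min_distance // addn2 subn1 addn1 prednK // (leq_trans _ hm).
by rewrite dim_DPhi ceil_DPhi.
Qed.

(** A dependency among the columns would be a word of the dual code with
    entries in F_q, hence of weight 1. *)
Lemma GPhi_free : free (qcols (GPhi phi)).
Proof.
apply/free_qcolsP=> c Gc0.
have yD : (map_mx (in_alg L) c)^T \in DPhi phi.
  by rewrite /DPhi mem_dual_row_code -trmx_mul Gc0 trmx0.
apply/eqP; rewrite -(map_mx_eq0 (in_alg L)) -trmx_eq0.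
apply: contraT => /(DPhi_weight yD)/leq_trans/(_ (rank_weight_Fq _ _)).
by rewrite leq_subLR => /(leq_trans hm).
Qed.

Lemma Uphi_q_system : q_system (l * m + s) (Uphi phi).
Proof.
split.
  rewrite UphiE; have := GPhi_free; rewrite /free => /eqP ->.
  by rewrite size_map size_enum_ord.
apply/eqP; rewrite eqEsubv subvf; apply/subvP=> v _.
have /row_freeP[B GB] := GPhi_row_free.
have -> : v = \sum_j (B *m v) j 0 *: col j (GPhi phi).
  rewrite -{1}[v]mul1mx -GB -mulmxA; apply/colP=> i.
  by rewrite mxE summxE; apply: eq_bigr => j _; rewrite !mxE mulrC.
apply: memv_suml => j _; rewrite memvZ //.
have /Fspan_subP := subvv (Fspan (Uphi phi)); apply.
by rewrite UphiE; apply/memv_span/map_f; rewrite mem_enum.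
Qed.

Lemma Uphi_scattered : scattered_system (l * m + s) (m - 3) (Uphi phi).
Proof.
split; first exact: Uphi_q_system.
rewrite UphiE; apply: scattered_of_dual_distance => y yG y0.
apply: leq_trans (DPhi_weight _ y0); last first.
  by rewrite /DPhi mem_dual_row_code yG.
by rewrite scatter_distance.
Qed.

Lemma gen_rank_weight_DPhi i : (i <= 2 * l)%N ->
  (gen_rank_weight i (row_code H0) <= gen_rank_weight i (DPhi phi))%N.
Proof.
move=> i2l; apply: gen_rank_weight_le; last by rewrite dim_DPhi.
  move=> y; rewrite mem_DPhi => /submxP[v ->].
  by rewrite mul_mx_row row_mxKl mem_row_code submxMl.
move=> y; rewrite mem_DPhi => /submxP[v ->].
rewrite mul_mx_row row_mxKl -(mul0mx _ H0) => /(row_free_inj H0_row_free) ->.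
by rewrite !mul0mx row_mx0.
Qed.

Lemma vpi_qcols_sum (e : 'cV[K]_s) :
  \sum_j e j 0 *: vpi W (col j Z) = vpi W (Z *m map_mx (in_alg L) e).
Proof.
by rewrite -sum_qcols linear_sum; apply: eq_bigr => j _; rewrite linearZ.
Qed.

Lemma vpi_eq0P w : vpi W w = 0 <-> w \in W.
Proof. by rewrite -[w in w \in W]subr0 -vpi_eq linear0. Qed.

(** The columns of H0 being a basis of W, a relation among those of [H0 | Z] is
    a relation among those of Z modulo W. *)
Lemma Ebar_dimP : \dim (Ebar W Z) = s <-> free (qcols HZ).
Proof.
have -> : (\dim (Ebar W Z) = s) <-> free [seq vpi W (col j Z) | j <- enum 'I_s].
  rewrite /Ebar /qcols -map_comp /free size_map size_enum_ord.
  by split=> [->|/eqP].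
have memW (c : 'cV[K]_(l * m)) : (H0 *m map_mx (in_alg L) c : qvec _ _) \in W.
  by rewrite -(span_basis hH0); apply/span_qcolsP; exists c.
have /free_qcolsP frH0 := basis_free hH0.
split=> [/free_familyP frE|/free_qcolsP frHZ].
  apply/free_qcolsP=> c; rewrite -[c]vsubmxK map_col_mx mul_row_col => c0.
  have d0 : dsubmx c = 0.
    apply: frE; rewrite vpi_qcols_sum; apply/vpi_eq0P.
    have /eqP := c0; rewrite addrC addr_eq0 => /eqP ->.
    by rewrite -mulmxN -map_mxN memW.
  move: c0; rewrite d0 map_mx0 mulmx0 addr0 => /frH0 ->.
  by rewrite col_mx0.
apply/free_familyP=> e; rewrite vpi_qcols_sum => /vpi_eq0P.
rewrite -(span_basis hH0) => /span_qcolsP[c Zc].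
have /(congr1 dsubmx) : col_mx (- c) e = 0.
  apply: frHZ; rewrite map_col_mx mul_row_col Zc map_mxN mulmxN.
  exact: addNr.
by rewrite col_mxKd linear0.
Qed.

Lemma DPhi_nondegenerate : free (qcols HZ) -> nondegenerate_code (DPhi phi).
Proof.
apply: nondegenerate_of_generator; rewrite DPhiE.
exact: generator_row_code HZ_row_free.
Qed.

(** A word of weight 1 is a multiple of a word c over F_q, and such a word is
    orthogonal to D_Phi when [H0 | Z] c = 0. *)
Lemma CPhi_weight_gt1P :
  free (qcols HZ) <->
  (forall y, y \in CPhi phi -> y != 0 -> (1 < rank_weight y)%N).
Proof.
split=> [/free_qcolsP fr y|wt].
  rewrite mem_CPhi => /eqP yHZ; apply: contraNT; rewrite -leqNgt.
  case/rank_weight1=> a [c yE]; have [a0|a0] := eqVneq a 0.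
    by rewrite yE a0 scale0r.
  rewrite yE (fr c) ?map_mx0 ?trmx0 ?scaler0 //.
  apply/trmx_inj; rewrite trmx_mul trmx0; apply: (scalerI a0).
  by rewrite scaler0 scalemxAl -yE.
apply/free_qcolsP=> c c0; apply/eqP.
rewrite -(map_mx_eq0 (in_alg L)) -trmx_eq0.
apply: contraT => /wt; rewrite mem_CPhi -trmx_mul c0 trmx0 eqxx => /(_ isT).
by rewrite ltnNge rank_weight_Fq.
Qed.

Lemma CPhi_min_distance : (1 <= s)%N ->
  free (qcols HZ) -> min_distance (CPhi phi) = 2.
Proof.
move=> hs1 /CPhi_weight_gt1P wt; apply: min_distance_eq wt.
apply: exists_small_word; first by rewrite (leq_trans _ hm).
by rewrite dim_CPhi count_CPhi.
Qed.

Lemma CPhi_quasi_MRD : (1 <= l)%N -> (1 <= s)%N -> (2 * s < m - 2)%N ->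
  free (qcols HZ) -> quasi_MRD (CPhi phi).
Proof.
move=> hl hs1 hs2 fr; apply: (@quasi_MRD_eq _ _ _ _ (m - 1)).
- exact: length_gt.
- by rewrite CPhi_min_distance // add2n subn1 prednK ?addn1 // (leq_trans _ hm).
- by rewrite subn_gt0 (leq_trans _ hm).
by rewrite dim_CPhi ceil_CPhi.
Qed.

Lemma CPhi_min_distance1 : ~ free (qcols HZ) -> min_distance (CPhi phi) = 1%N.
Proof.
move=> nfr; apply: min_distance_eq => [|y _]; last exact: rank_weight_gt0.
apply: contrapT => /forallNP noy; apply/nfr/CPhi_weight_gt1P => y Cy y0.
by rewrite ltnNge; apply/negP => wy; apply: (noy y).
Qed.

End Construction.

Theorem theorem3p2 (K : finFieldType) (L : fieldExtType K) (m l s : nat)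
  (hL : \dim {:L} = m) (hm : (5 <= m)%N) (hl : (1 <= l)%N)
  (W : {vspace qvec L (2 * l)}) (hW : maximum_scattered W)
  (H0 : 'M[L]_(2 * l, l * m)) (hH0 : basis_of W (qcols H0))
  (G0 : 'M[L]_(l * (m - 2), l * m))
  (hG0 : generator_matrix (dual_code (row_code H0)) G0)
  (hs1 : (1 <= s)%N) (hs2 : (2 * s < m - 2)%N)
  (phi : 'Hom(subvs_of (U0 G0), qvec L s)) :
  [/\ [/\ extremal_system (l * m + s) (m - 3) (Uphi phi),
          quasi_maximum_system (l * m + s) (m - 3) (Uphi phi),
          associated (CPhi phi) (Uphi phi) /\ nondegenerate_code (CPhi phi)
        & quasi_MRD (DPhi phi) /\ code_params (DPhi phi) (2 * l) (m - 1)],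
      forall i : nat, (1 <= i <= 2 * l)%N ->
        (gen_rank_weight i (row_code H0) <= gen_rank_weight i (DPhi phi))%N,
      \dim (Ebar W (Zmat phi H0)) = s ->
        [/\ nondegenerate_code (CPhi phi) /\ nondegenerate_code (DPhi phi),
            quasi_MRD (CPhi phi) /\ quasi_MRD (DPhi phi),
            code_params (CPhi phi) (l * (m - 2) + s) 2
          & code_params (DPhi phi) (2 * l) (m - 1)]
    & (\dim (Ebar W (Zmat phi H0)) < s)%N ->
        min_distance (CPhi phi) = 1%N].
Proof.
subst m.
have genG : generator_matrix (CPhi phi) (GPhi phi).
  exact/generator_row_code/(GPhi_row_free hG0).
have freeG := GPhi_free hm hW hH0 hG0 phi.
have ndC := nondegenerate_of_generator genG freeG.
have ext : extremal_system (l * \dim {:L} + s) (\dim {:L} - 3) (Uphi phi).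
  by split; [exact: (Uphi_scattered hm hW hH0 hG0 phi) | exact: rank_extremal].
have paramsD : code_params (DPhi phi) (2 * l) (\dim {:L} - 1).
  split; first exact: (dim_DPhi hm hW hH0 hG0 phi).
  exact: (DPhi_min_distance hm hW hH0 hG0 phi hl hs2).
have qD : quasi_MRD (DPhi phi).
  exact: (DPhi_quasi_MRD hm hW hH0 hG0 phi hl hs1 hs2).
split.
- split=> //; first by split=> //; apply: rank_not_maximum.
  by split=> //; exists (GPhi phi); rewrite UphiE.
- by move=> i /andP[_ ?]; apply: (gen_rank_weight_DPhi hm hW hH0 hG0 phi).
- move/(Ebar_dimP hH0) => fr; split=> //.
  + by split=> //; apply: (DPhi_nondegenerate hm hW hH0 hG0 fr).
  + by split=> //; apply: (CPhi_quasi_MRD hm hW hH0 hG0 hl hs1 hs2 fr).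
  split; first exact: (dim_CPhi hG0 phi).
  exact: (CPhi_min_distance hm hW hH0 hG0 hs1 fr).
move=> lts; apply: (CPhi_min_distance1 hm hW hH0 hG0).
by move/(Ebar_dimP hH0) => eqs; rewrite eqs ltnn in lts.
Qed.
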